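(* Let $n\ge 1$, let $\lambda,\beta>0$, and let $\alpha_1,\dots,\alpha_n>0$ and $\alpha_1^*,\dots,\alpha_n^*>0$. Let $X_1,\dots,X_n$ be independent random variables with $X_i\sim \mathrm{ENH}(\alpha_i,\lambda,\beta)$, and let $X_1^*,\dots,X_n^*$ be independent random variables with $X_i^*\sim \mathrm{ENH}(\alpha_i^*,\lambda,\beta)$, $i=1,\dots,n$. Write $X_{n:n}=\max_i X_i$ and $X^*_{n:n}=\max_i X_i^*$. If $\alpha_i\le\alpha_i^*$ for every $i=1,\dots,n$, then $X_{n:n}\ge_{\mathrm{st}}X^*_{n:n}$.
   Context: For $\alpha,\lambda,\beta>0$, $X\sim \mathrm{ENH}(\alpha,\lambda,\beta)$ (exponentiated Nadarajah-Haghighi distribution) means that $X$ is a positive random variable with distribution function $[1-\exp\{1-(1+\lambda x)^{\alpha}\}]^{\beta}$ for $x>0$ (and $0$ for $x\le 0$). Usual stochastic order: $X\le_{\mathrm{st}}Y$ (equivalently $Y\ge_{\mathrm{st}}X$) means $P(X>x)\le P(Y>x)$ for all $x$. *)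

(* Defs.v *)
From HB Require Import structures.
From mathcomp Require Import all_boot all_order all_algebra.
From mathcomp Require Import all_classical all_reals all_analysis.
From mathcomp Require Import measurable_realfun.

Set Implicit Arguments.
Unset Strict Implicit.
Unset Printing Implicit Defensive.

Import Order.TTheory GRing.Theory Num.Theory.
Import numFieldNormedType.Exports.

Local Open Scope classical_set_scope.
Local Open Scope ring_scope.

Definition enh_cdf (R : realType) (alpha lambda beta x : R) : R :=
  if 0 < x then (1 - expR (1 - (1 + lambda * x) `^ alpha)) `^ beta else 0.

(* Positivity of X is only almost sure: it is the case x = 0 of the equation. *)
Definition is_ENH d (T : measurableType d) (R : realType) (P : probability T R)
    (X : {RV P >-> R}) (alpha lambda beta : R) : Prop :=
  forall x : R, cdf X x = (enh_cdf alpha lambda beta x)%:E.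

Definition mutually_independent d (T : measurableType d) (R : realType)
    (P : probability T R) (n : nat) (X : 'I_n -> {RV P >-> R}) : Prop :=
  forall (J : {set 'I_n}) (A : 'I_n -> set R),
    (forall i, measurable (A i)) ->
    P (\bigcap_(i in [set` J]) (X i @^-1` A i)) =
    (\prod_(i in J) P (X i @^-1` A i))%E.

Section sample_max.
Context d (T : measurableType d) (R : realType) (P : probability T R).
Context (n : nat) (n_gt0 : (0 < n)%N) (X : 'I_n -> {RV P >-> R}).

(* The seed of the iterated maximum is one of the X_i, so that no default
   value (such as 0) interferes with the maximum. *)
Definition sample_max_fun (w : T) : R :=
  \big[Num.max/X (Ordinal n_gt0) w]_(i < n) X i w.

Lemma measurable_sample_max_fun : measurable_fun [set: T] sample_max_fun.
Proof.
rewrite /sample_max_fun; elim: (index_enum _) => [|i s IHs].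
  by under eq_fun do rewrite big_nil; exact: measurable_funPT.
under eq_fun do rewrite big_cons.
by apply: measurable_maxr => //; exact: measurable_funPT.
Qed.

HB.instance Definition _ :=
  isMeasurableFun.Build _ _ _ _ sample_max_fun measurable_sample_max_fun.

Definition sample_max : {RV P >-> R} := sample_max_fun.

End sample_max.

(* The two variables may live on different probability spaces. *)
Definition st_le d (T : measurableType d) d' (T' : measurableType d')
    (R : realType) (P : probability T R) (Q : probability T' R)
    (X : {RV P >-> R}) (Y : {RV Q >-> R}) : Prop :=
  forall x : R, (ccdf X x <= ccdf Y x)%E.

(* Main.v *)
Require Import Defs.
From HB Require Import structures.
From mathcomp Require Import all_boot all_order all_algebra.
From mathcomp Require Import all_classical all_reals all_analysis.

Set Implicit Arguments.
Unset Strict Implicit.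
Unset Printing Implicit Defensive.

Import Order.TTheory GRing.Theory Num.Theory.
Import numFieldNormedType.Exports.

Local Open Scope classical_set_scope.
Local Open Scope ring_scope.

(** The distribution function of the maximum of independent variables is the
product of their distribution functions ([cdf_sample_max]): the maximum is at
most [x] exactly when every variable is.  Distribution functions are
nonnegative, so their product grows with each factor; hence stochastic order
passes from independent components to their maxima ([st_le_sample_max]).

What remains is a statement on one variable: for [x > 0] the base
[1 + lambda * x] exceeds [1], so raising the exponent [alpha] increases
[(1 + lambda * x) `^ alpha], decreases [expR (1 - (1 + lambda * x) `^ alpha)]
and increases the distribution function ([le_enh_cdf]).  A larger [alpha] thus
gives a stochastically smaller variable. *)

Lemma st_leP d (T : measurableType d) d' (T' : measurableType d')
    (R : realType) (P : probability T R) (Q : probability T' R)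
    (X : {RV P >-> R}) (Y : {RV Q >-> R}) :
  st_le X Y <-> forall x : R, (cdf Y x <= cdf X x)%E.
Proof.
split=> XY x.
- by rewrite !cdf_1_ccdf leeB.
- by rewrite !ccdf_1_cdf leeB.
Qed.

Lemma lee_prod_nonneg (R : realDomainType) (I : Type) (r : seq I) (S : pred I)
    (f g : I -> \bar R) :
  (forall i, S i -> (0 <= f i)%E) -> (forall i, S i -> (f i <= g i)%E) ->
  (\prod_(i <- r | S i) f i <= \prod_(i <- r | S i) g i)%E.
Proof.
move=> f_ge0 fg.
(* Multiplying two inequalities requires their lower sides to be nonnegative,
   so this is carried along. *)
suff /andP[_] : (0 <= \prod_(i <- r | S i) f i
                  <= \prod_(i <- r | S i) g i)%E by [].
apply: (big_ind2 (fun a b => (0 <= a <= b)%E)) => [|a b c e|i Si].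
- by rewrite lee01 lexx.
- by move=> /andP[a0 ab] /andP[c0 ce]; rewrite mule_ge0//= lee_pmul.
- by rewrite f_ge0// fg.
Qed.

Lemma cdf_sample_max d (T : measurableType d) (R : realType)
    (P : probability T R) (n : nat) (n_gt0 : (0 < n)%N)
    (X : 'I_n -> {RV P >-> R}) (x : R) :
  mutually_independent X ->
  cdf (sample_max n_gt0 X) x = (\prod_(i < n) cdf (X i) x)%E.
Proof.
move=> X_indep.
have maxE : sample_max n_gt0 X @^-1` `]-oo, x] =
    \bigcap_(i in [set` [set: 'I_n]%SET]) (X i @^-1` `]-oo, x]).
  apply/seteqP; split=> w /=; rewrite in_itv/= /sample_max_fun.
  + by move=> /bigmax_leP[_ Xx] i _; rewrite /= in_itv/=; exact: Xx.
  + move=> Xx; have {}Xx i : X i w <= x.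
      by have := Xx i; rewrite /= finset.in_setT in_itv/=; exact.
    by apply/bigmax_leP; split.
rewrite /cdf /distribution /pushforward maxE X_indep//.
by apply: eq_bigl => i; rewrite finset.in_setT.
Qed.

(** The samples may live on different probability spaces, so they are compared
through their distribution functions, factor by factor in [cdf_sample_max],
rather than pointwise. *)
Lemma st_le_sample_max d (T : measurableType d) d' (T' : measurableType d')
    (R : realType) (P : probability T R) (Q : probability T' R)
    (n : nat) (n_gt0 : (0 < n)%N)
    (X : 'I_n -> {RV P >-> R}) (Y : 'I_n -> {RV Q >-> R}) :
  mutually_independent X -> mutually_independent Y ->
  (forall i, st_le (X i) (Y i)) ->
  st_le (sample_max n_gt0 X) (sample_max n_gt0 Y).
Proof.
move=> X_indep Y_indep XY; apply/st_leP => x.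
rewrite !cdf_sample_max//; apply: lee_prod_nonneg => i _.
- exact: measure_ge0.
- by have /st_leP := XY i; exact.
Qed.

(** The sign of [alpha] matters: it makes the power at least [1], so that the
base raised to [beta] is nonnegative, where [powR] is monotone. *)
Lemma le_enh_cdf (R : realType) (alpha alpha' lambda beta x : R) :
  0 <= lambda -> 0 <= beta -> 0 <= alpha -> alpha <= alpha' ->
  enh_cdf alpha lambda beta x <= enh_cdf alpha' lambda beta x.
Proof.
move=> lambda_ge0 beta_ge0 alpha_ge0 alpha_le; rewrite /enh_cdf.
case: (boolP (0 < x)) => [x_gt0|_]; last exact: lexx.
have base_ge1 : 1 <= 1 + lambda * x by rewrite lerDl mulr_ge0// ltW.
have nneg a : 0 <= a -> 1 - expR (1 - (1 + lambda * x) `^ a) \is Num.nneg.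
  move=> a_ge0; rewrite nnegrE subr_ge0 -[leRHS]expR0 ler_expR subr_le0.
  by rewrite -[leLHS](powRr0 (1 + lambda * x)) ler_powR.
apply: (ge0_ler_powR beta_ge0) => //; first exact: nneg.
- exact/nneg/(le_trans alpha_ge0).
- by rewrite lerB// ler_expR lerB// ler_powR.
Qed.

Theorem theorem3p3 (R : realType)
    (d : measure_display) (T : measurableType d) (P : probability T R)
    (d' : measure_display) (T' : measurableType d') (P' : probability T' R)
    (n : nat) (n_gt0 : (0 < n)%N)
    (lambda beta : R) (lambda_gt0 : 0 < lambda) (beta_gt0 : 0 < beta)
    (alpha alpha' : 'I_n -> R)
    (alpha_gt0 : forall i, 0 < alpha i) (alpha'_gt0 : forall i, 0 < alpha' i)
    (X : 'I_n -> {RV P >-> R}) (X' : 'I_n -> {RV P' >-> R})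
    (X_indep : mutually_independent X) (X'_indep : mutually_independent X')
    (X_ENH : forall i, is_ENH (X i) (alpha i) lambda beta)
    (X'_ENH : forall i, is_ENH (X' i) (alpha' i) lambda beta)
    (alpha_le : forall i, alpha i <= alpha' i) :
  st_le (sample_max n_gt0 X') (sample_max n_gt0 X).
Proof.
apply: st_le_sample_max => // i; apply/st_leP => x.
by rewrite X_ENH X'_ENH lee_fin le_enh_cdf// ltW.
Qed.
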